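(* Let $X,Y,Z$ be real reflexive Banach spaces and let $\pi:X\to Z$ be linear, continuous and completely continuous (i.e. $v_n\rightharpoonup v$ in $X$ implies $\pi v_n\to\pi v$ in $Z$). Let $(A,b,J,f,\Lambda)$ be an admissible data tuple and, for each $n\in\mathbb N$, let $(A_n,b_n,J_n,f_n,\Lambda_n)$ be an admissible data tuple with function $h_n$ and constants $r_n,\alpha_n,c_n,M_n,q_n,m_n$ (and local Lipschitz constants $L_S^n$); ''admissible data tuple'' is defined in the context. Let $(u,\lambda)$ be the unique solution of the mixed problem with data $(A,b,J,f,\Lambda)$ and let $(u_n,\lambda_n)$ be the unique solution of the mixed problem with data $(A_n,b_n,J_n,f_n,\Lambda_n)$. Assume: (a) there exist $\widetilde\delta$ and, for each $n$, numbers $F_n\ge0$, $\delta_n\ge0$ such that $\|A_nv-Av\|_{X'}\le F_n(\|v\|_X+\delta_n)$ for all $v\in X$, $\lim F_n=0$, and $\delta_n\le\widetilde\delta$ for all $n$; (b) for each $w\in X$ the map $v\mapsto J(w,v)$ is weakly lower semicontinuous on $X$, and for each sequence $\{w_n\}\subset X$ with $w_n\rightharpoonup \widetilde w$ in $X$ one has $\limsup[J(\widetilde w,w_n-\widetilde w)-J_n(\widetilde w,w_n-\widetilde w)]\le0$ and $\limsup[J_n(w_n,v-w_n)-J(w_n,v-w_n)]\le0$ for all $v\in X$; (c) there exists $M_0>0$ with $M_n-m_n\ge M_0$ for all $n$; (d) there exists $\widetilde q>0$ with $q_n\ge\widetilde q$ for all $n$; (e) there exists $\widetilde c$ with $c_n\le\widetilde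 c$ for all $n$; (f) for all sequences $z_n\rightharpoonup z$ in $X$ and $\mu_n\rightharpoonup\mu$ in $Y$, $\limsup b_n(w-z_n,\mu_n)\le b(w-z,\mu)$ for all $w\in X$; (g) there exists $\alpha_0>0$ with $\alpha_n\ge\alpha_0$ for all $n$; (h) $\Lambda_n$ converges to $\Lambda$ in the sense of Mosco: for each $\mu\in\Lambda$ there is a sequence $\{\mu_n\}$ with $\mu_n\in\Lambda_n$ for each $n$ and $\mu_n\to\mu$ in $Y$; and for each sequence $\{\mu_n\}$ with $\mu_n\in\Lambda_n$ for each $n$ and $\mu_n\rightharpoonup\mu$ in $Y$, one has $\mu\in\Lambda$; (i) $f_n\rightharpoonup f$ in $Z'$. Then $u_n\to u$ strongly in $X$ and $\lambda_n\rightharpoonup\lambda$ weakly in $Y$.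
   Context: $(\cdot,\cdot)_{X',X}$, $(\cdot,\cdot)_{Z',Z}$ denote duality pairings; $\to$ and $\rightharpoonup$ denote strong and weak convergence; limits are as $n\to\infty$. Mixed problem with data $(A,b,J,f,\Lambda)$ (and fixed $\pi$): find $(u,\lambda)\in X\times\Lambda$ such that $$(Au,v-u)_{X',X}+b(v-u,\lambda)+J(u,v-u)\ge (f,\pi(v-u))_{Z',Z}\quad\forall v\in X,\qquad b(u,\mu-\lambda)\le0\quad\forall\mu\in\Lambda.$$ Admissible data tuple: $A:X\to X'$, $b:X\times Y\to\mathbb R$, $J:X\times X\to\mathbb R$, $f\in Z'$, $\Lambda\subset Y$ such that, for some function $h$ and constants $r,\alpha,c,M,q,m$: (1) $h:X\to\mathbb R$ and $r>1$ satisfy: $h(tw)=t^rh(w)$ for all $t>0$, $w\in X$; $(Av-Au,v-u)_{X',X}\ge h(v-u)$ for all $u,v\in X$; $w_k\rightharpoonup w$ in $X$ implies $h(w)\le\limsup_k h(w_k)$; (2) $A$ is continuous; (3) $(Au,u)_{X',X}/\|u\|_X\to\infty$ as $\|u\|_X\to\infty$; (4) $b$ is bilinear; $w_k\rightharpoonup w$ in $X$ implies $b(w_k,\mu)\to b(w,\mu)$ for all $\mu\in Y$; $\mu_k\rightharpoonup\mu$ in $Y$ implies $b(v,\mu_k)\to b(v,\mu)$ for all $v\in X$; $\alpha>0$ and $\inf_{\mu\in Y,\mu\ne0}\sup_{v\in X,v\ne0}\frac{b(v,\mu)}{\|v\|_X\|\mu\|_Y}\ge\alpha$; (5) for every $u\in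 X$, $v\mapsto J(u,v)$ is positively homogeneous and subadditive; $c>0$ and $|J(u,v)|\le c\|v\|_X$ for all $u,v\in X$; $w_k\rightharpoonup w$, $v_k\rightharpoonup v$ in $X$ imply $\limsup_k J(w_k,v_k)\le J(w,v)$; (6) $\Lambda$ is a closed convex bounded subset of $Y$ containing $0_Y$; (7) $M>0$, $q\ge2$ and $h(v)\ge M\|v\|_X^q$ for all $v\in X$; (8) $m\ge0$ and $J(w_1,w_2-w_1)+J(w_2,w_1-w_2)\le m\|w_1-w_2\|_X^q$ for all $w_1,w_2\in X$; (9) $M>m$; (10) $J(u,v)+J(u,-v)\le0$ for all $u,v\in X$; (11) for each nonempty bounded $S\subset X$ there is $L_S>0$ with $\|Au-Av\|_{X'}\le L_S\|u-v\|_X$ for all $u,v\in S$. For linear continuous $\pi$ and an admissible data tuple, the mixed problem has a unique solution.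
   Formalization: In (h), the second Mosco condition is required along subsequences (weak limits of μ_j ∈ Λ_{k_j}, k strictly increasing, lie in Λ), as in the standard definition; with full sequences only, the claim fails, e.g. in R for Λ={0}, Λ_n={0} for odd n and [0,1] for even n. *)

(* Defs.v *)
From HB Require Import structures.
From mathcomp Require Import all_boot all_order all_algebra.
From mathcomp Require Import all_classical all_reals all_analysis.

Set Implicit Arguments.
Unset Strict Implicit.
Unset Printing Implicit Defensive.

Import Order.TTheory GRing.Theory Num.Theory.
Import numFieldNormedType.Exports.

Local Open Scope classical_set_scope.
Local Open Scope ring_scope.

Section Dual.
Context (R : realType) (V : normedModType R).

Definition is_dual : {pred V -> R^o} :=
  fun f => `[< linear f /\ continuous f >].

Lemma is_dual_submod_closed : submod_closed is_dual.
Proof.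
split.
  apply/asboolP; split; last by move=> x; exact: cvg_cst.
  by move=> a u v /=; rewrite scaler0 addr0.
move=> a f g /asboolP[lf cf] /asboolP[lg cg]; apply/asboolP; split.
  move=> k u v; rewrite [LHS](_ : _ = a *: f (k *: u + v) + g (k *: u + v))//.
  rewrite lf lg !scalerDr !scalerA (mulrC a k) -!scalerA addrACA.
  by rewrite -scalerDr.
move=> x; have h : a *: f y @[y --> x] --> a *: f x by apply: cvgZl_tmp; exact: cf.
exact: cvgD h (cg x).
Qed.

HB.instance Definition _ := GRing.isSubmodClosed.Build R (V -> R^o) is_dual
  is_dual_submod_closed.

Record dual := Dual { dual_fun : V -> R^o ; dual_funP : dual_fun \in is_dual }.

HB.instance Definition _ := [isSub of dual for dual_fun].
HB.instance Definition _ := [Choice of dual by <:].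
HB.instance Definition _ := [SubChoice_isSubLmodule of dual by <:].

(* The duality pairing (f, x)_{V',V} is written f x. *)
Definition pairing (f : dual) : V -> R := dual_fun f.
Local Coercion pairing : dual >-> Funclass.

Lemma pairing_scalar (f : dual) : scalar f.
Proof. by case: f => f /= /asboolP[]. Qed.

Lemma pairing_continuous (f : dual) : continuous f.
Proof. by case: f => f /= /asboolP[]. Qed.

HB.instance Definition _ (f : dual) :=
  GRing.isLinear.Build R V R *%R f (pairing_scalar f).

Let dual_ball (f : dual) := [set `|f x| | x in [set x | `|x| <= 1]].

Definition dual_norm (f : dual) : R := sup (dual_ball f).

Let dual_bound (f : dual) : exists2 M : R, 0 <= M & forall x, `|f x| <= M * `|x|.
Proof.
have /linear_bounded_continuous/linear_boundedP := @pairing_continuous f.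
move=> /pinfty_ex_gt0[M M0 fM]; exists M => //; exact: ltW.
Qed.

Let dual_ball_sup (f : dual) : has_sup (dual_ball f).
Proof.
split; first by exists `|f 0|, 0 => //=; rewrite normr0.
have [M M0 fM] := dual_bound f; exists M => _ [x /= x1 <-].
by rewrite (le_trans (fM x))// ler_piMr.
Qed.

Let dual_norm_ub (f : dual) x : `|x| <= 1 -> `|f x| <= dual_norm f.
Proof.
by move=> x1; apply: (sup_upper_bound (dual_ball_sup f)); exists x.
Qed.

Let dual_norm_le (f : dual) (M : R) :
  (forall x, `|x| <= 1 -> `|f x| <= M) -> dual_norm f <= M.
Proof.
move=> fM; apply: ge_sup; first by case: (dual_ball_sup f).
by move=> _ [x /= x1 <-]; exact: fM.
Qed.

Let dual_normD (f g : dual) : dual_norm (f + g) <= dual_norm f + dual_norm g.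
Proof.
apply: dual_norm_le => x x1.
by rewrite (le_trans (ler_normD _ _))// lerD// dual_norm_ub.
Qed.

Let dual_normZ_le (a : R) (f : dual) : dual_norm (a *: f) <= `|a| * dual_norm f.
Proof.
apply: dual_norm_le => x x1.
by rewrite [leLHS](normrM a (f x)) ler_wpM2l// dual_norm_ub.
Qed.

Let dual_normZ (a : R) (f : dual) : dual_norm (a *: f) = `|a| * dual_norm f.
Proof.
apply/eqP; rewrite eq_le dual_normZ_le/=.
have [->|a0] := eqVneq a 0.
  rewrite normr0 mul0r.
  by apply: le_trans (normr_ge0 ((0 *: f : dual) 0)) _; apply: dual_norm_ub; rewrite normr0.
rewrite -ler_pdivlMl ?normr_gt0// -normfV.
by rewrite -[in leLHS](scalerK a0 f) dual_normZ_le.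
Qed.

Let dual_norm0 (f : dual) : dual_norm f = 0 -> f = 0.
Proof.
move=> f0; apply/val_inj/funext => x /=; change (f x = 0).
have [->|x0] := eqVneq x 0; first exact: (linear0 f).
have /dual_norm_ub : `| (`|x|^-1 *: x) | <= 1.
  by rewrite normrZ normfV normr_id mulVf ?normr_eq0.
move=> /(_ f); rewrite f0 normr_le0 linearZ/= mulf_eq0 invr_eq0 normr_eq0.
by rewrite (negPf x0) => /eqP.
Qed.

HB.instance Definition _ :=
  Lmodule_isNormed.Build R dual dual_normD dual_normZ dual_norm0.

Lemma dual_normE (f : dual) :
  `|f| = sup [set `|f x| | x in [set x | `|x| <= 1]].
Proof. by []. Qed.

End Dual.
Coercion pairing : dual >-> Funclass.

Section Weak.
Context (R : realType).

Definition reflexive_space (V : normedModType R) : Prop :=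
  forall phi : dual (dual V), exists x : V, forall f : dual V, phi f = f x.

(* The weak topology: the coarsest one making every f in V' continuous. *)
Definition weak (V : normedModType R) : Type :=
  initial_topology
    ((fun x f => pairing f x) : V -> prod_topology (fun _ : dual V => R)).

HB.instance Definition _ (V : normedModType R) := Topological.on (weak V).

Definition weak_cvg (V : normedModType R) (u : nat -> V) (l : V) : Prop :=
  (u : nat -> weak V) @ \oo --> (l : weak V).

Lemma weak_cvgP (V : normedModType R) (u : nat -> V) (l : V) :
  weak_cvg u l <-> forall f : dual V, f (u n) @[n --> \oo] --> f l.
Proof.
split=> [ul f|ul].
  have ev_l := cvg_trans (cvg_app _ ul) (@initial_continuous _ _ _ l).
  exact: (cvg_trans (cvg_app _ ev_l) (@proj_continuous _ _ f _)).
move=> A /= [_ [[B Bop <-] Bl sBA]].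
pose ev (x : V) : {ptws dual V -> R} := fun f => pairing f x.
have evl : ev \o u @ \oo --> ev l by apply/pointwise_cvgP => f; exact: ul.
have : \forall n \near \oo, B (ev (u n)) by apply: evl; exact: open_nbhs_nbhs.
by apply: filterS => n; exact: sBA.
Qed.

End Weak.

(* The second clause is along subsequences, as in Mosco's definition: every
   weak cluster point of the Ln n lies in L. Restricting it to k = id would not
   bound the sequence Ln from above: on the real line the sets Ln n = {0} for
   odd n and Ln n = [0, 1] for even n would then converge to {0}. *)
Definition mosco_cvg (R : realType) (Y : normedModType R)
    (Ln : nat -> set Y) (L : set Y) : Prop :=
  (forall mu, L mu ->
     exists2 m : nat -> Y, (forall n, Ln n (m n)) & m @ \oo --> mu) /\
  (forall (k : nat -> nat) (m : nat -> Y) (mu : Y), increasing_seq k ->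
     (forall j, Ln (k j) (m j)) -> weak_cvg m mu -> L mu).

Section MixedProblem.
Context (R : realType) (X Y Z : normedModType R).

Record mixed_data := MixedData {
  opA : X -> dual X ;
  formb : X -> Y -> R ;
  funJ : X -> X -> R ;
  rhsf : dual Z ;
  setLambda : set Y
}.

Definition mixed_solution (pi : X -> Z) (D : mixed_data) (u : X) (lambda : Y) :
    Prop :=
  [/\ setLambda D lambda,
      forall v : X,
        rhsf D (pi (v - u)) <=
        opA D u (v - u) + formb D (v - u) lambda + funJ D u (v - u)
    & forall mu : Y, setLambda D mu -> formb D u (mu - lambda) <= 0].

Definition inf_sup (b : X -> Y -> R) : \bar R :=
  ereal_inf [set ereal_sup [set (b v mu / (`|v| * `|mu|))%:E
                           | v in [set v : X | v != 0]]
            | mu in [set mu : Y | mu != 0]].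

Record constants := Constants {
  ch : X -> R ;
  cr : R ;
  calpha : R ;
  cc : R ;
  cM : R ;
  cq : R ;
  cm : R
}.

Record admissible (D : mixed_data) (K : constants) : Prop := Admissible {
  h_exponent : 1 < cr K ;
  h_homogeneous : forall (t : R) (w : X), 0 < t ->
    ch K (t *: w) = t `^ cr K * ch K w ;
  A_h_monotone : forall u v : X, ch K (v - u) <= (opA D v - opA D u) (v - u) ;
  h_weak_limsup : forall (w : nat -> X) (w0 : X), weak_cvg w w0 ->
    ((ch K w0)%:E <= limn_esup (fun k => (ch K (w k))%:E))%E ;
  A_continuous : continuous (opA D) ;
  A_coercive : forall B : R, exists rho : R, forall u : X, rho < `|u| ->
    B < opA D u u / `|u| ;
  b_bilinear : bilinear_for *%R *%R (formb D) ;
  b_weak_continuous_l : forall (w : nat -> X) (w0 : X), weak_cvg w w0 ->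
    forall mu : Y, formb D (w k) mu @[k --> \oo] --> formb D w0 mu ;
  b_weak_continuous_r : forall (mu : nat -> Y) (mu0 : Y), weak_cvg mu mu0 ->
    forall v : X, formb D v (mu k) @[k --> \oo] --> formb D v mu0 ;
  alpha_gt0 : 0 < calpha K ;
  b_inf_sup : ((calpha K)%:E <= inf_sup (formb D))%E ;
  J_homogeneous : forall (u v : X) (t : R), 0 < t ->
    funJ D u (t *: v) = t * funJ D u v ;
  J_subadditive : forall u v1 v2 : X,
    funJ D u (v1 + v2) <= funJ D u v1 + funJ D u v2 ;
  c_gt0 : 0 < cc K ;
  J_bounded : forall u v : X, `|funJ D u v| <= cc K * `|v| ;
  J_weak_limsup : forall (w v : nat -> X) (w0 v0 : X),
    weak_cvg w w0 -> weak_cvg v v0 ->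
    (limn_esup (fun k => (funJ D (w k) (v k))%:E) <= (funJ D w0 v0)%:E)%E ;
  Lambda_closed : closed (setLambda D) ;
  Lambda_convex : convex_set (setLambda D) ;
  Lambda_bounded : bounded_set (setLambda D) ;
  Lambda_zero : setLambda D 0 ;
  M_gt0 : 0 < cM K ;
  q_ge2 : 2 <= cq K ;
  h_lower_bound : forall v : X, cM K * `|v| `^ cq K <= ch K v ;
  m_ge0 : 0 <= cm K ;
  J_relaxed_monotone : forall w1 w2 : X,
    funJ D w1 (w2 - w1) + funJ D w2 (w1 - w2) <= cm K * `|w1 - w2| `^ cq K ;
  m_lt_M : cm K < cM K ;
  J_opposite : forall u v : X, funJ D u v + funJ D u (- v) <= 0 ;
  A_loc_lipschitz : forall S : set X, S !=set0 -> bounded_set S ->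
    exists2 L : R, 0 < L &
      forall u v : X, S u -> S v -> `|opA D u - opA D v| <= L * `|u - v|
}.

End MixedProblem.

(* Main.v *)
(* The solutions u_n and lambda_n are bounded, so by reflexivity every
   subsequence has a further one along which both converge weakly. Testing the
   n-th inequality with the weak limit of the u_n and using the strong
   monotonicity of A upgrades weak to strong convergence of the u_n, which lets
   one pass to the limit in both inequalities. The weak limit then solves the
   limit problem, hence is (u, lambda), and the whole sequences converge.

   Weak sequential compactness is obtained from ultrafilters: a bounded sequence
   converges weakly along any ultrafilter, and a subsequence is chosen along
   which countably many functionals, separating the points of the closed span
   of the sequence, converge. *)

Require Import Defs.
From HB Require Import structures.
From mathcomp Require Import all_boot all_order all_algebra.
From mathcomp Require Import all_classical all_reals all_analysis.
From mathcomp Require Import lra.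

Set Implicit Arguments.
Unset Strict Implicit.
Unset Printing Implicit Defensive.

Import Order.TTheory GRing.Theory Num.Theory.
Import numFieldNormedType.Exports.

Local Open Scope classical_set_scope.
Local Open Scope ring_scope.

(** * The Hahn-Banach theorem *)

Section HahnBanach.
Context (R : realType) (V : lmodType R).
Implicit Types (p q : V -> R) (x y : V).

Definition sublinear p :=
  (forall x y, p (x + y) <= p x + p y) /\
  (forall t x, 0 <= t -> p (t *: x) = t * p x).

Lemma sublinear0 p : sublinear p -> p 0 = 0.
Proof. by case=> _ /(_ 0 0 (lexx _)); rewrite scale0r mul0r. Qed.

Lemma sublinearN p x : sublinear p -> - p (- x) <= p x.
Proof.
by move=> sp; rewrite -subr_ge0 opprK -(sublinear0 sp) -(subrr x); exact: sp.1.
Qed.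

(** It suffices that the family be directed: sums and positive multiples of members dominate another
    member. This covers the shifts of a sublinear map, chains in Zorn's lemma, and the distance to a
    span. *)
Lemma inf_sublinear (I : Type) (P : set I) (F : I -> V -> R) :
    P !=set0 ->
    (forall x, exists m, forall i, P i -> m <= F i x) ->
    (forall i j, P i -> P j -> exists2 k, P k &
      forall x y, F k (x + y) <= F i x + F j y) ->
    (forall t i, 0 < t -> P i -> exists2 k, P k &
      forall x, F k (t *: x) <= t * F i x) ->
    (forall i, P i -> 0 <= F i 0) ->
  let p x := inf [set F i x | i in P] in
  sublinear p /\ forall i x, P i -> p x <= F i x.
Proof.
move=> [i0 Pi0] Flb FD FZ F0 p.
have pF i x : P i -> p x <= F i x.
  move=> Pi; apply: ge_inf; last by exists i.
  by have [m mF] := Flb x; exists m => _ [j Pj <-]; exact: mF.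
have le_p x m : (forall i, P i -> m <= F i x) -> m <= p x.
  by move=> mF; apply: lb_le_inf => [|_ [i Pi <-]]; [exists (F i0 x), i0|exact: mF].
have pZ_le t x : 0 < t -> p (t *: x) <= t * p x.
  move=> t0; rewrite -ler_pdivrMl//; apply: (le_p) => i Pi.
  have [k Pk kF] := FZ _ _ t0 Pi; rewrite ler_pdivrMl//.
  by rewrite (le_trans _ (kF _))// pF.
have p0 : p 0 = 0.
  (* Scaling by 1/2 gives [p 0 <= p 0 / 2], hence [p 0 <= 0]. *)
  apply/eqP; rewrite eq_le le_p// andbT.
  have := @pZ_le 2^-1 0; rewrite scaler0 => /(_ ltac:(by rewrite invr_gt0)).
  by lra.
split=> //; split=> [x y|t x].
  rewrite -lerBlDr; apply: (le_p) => i Pi; rewrite lerBlDr -lerBlDl.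
  apply: (le_p) => j Pj; rewrite lerBlDl.
  by have [k Pk kF] := FD _ _ Pi Pj; rewrite (le_trans _ (kF _ _))// pF.
rewrite le_eqVlt => /predU1P[<-|t0]; first by rewrite scale0r mul0r.
apply/eqP; rewrite eq_le pZ_le//= -ler_pdivlMl//.
by rewrite -[in leLHS](scalerK (lt0r_neq0 t0) x) pZ_le// invr_gt0.
Qed.

(** Take [q x] to be the infimum over [t >= 0] of [p (x + t *: y) - t * p y]: the value [t = 0]
    gives [q <= p], and [t = 1] gives the bound at [- y]. *)
Lemma sublinear_shift p y : sublinear p ->
  exists q, [/\ sublinear q, forall x, q x <= p x & q (- y) <= - p y].
Proof.
move=> sp; have [pD pZ] := sp.
pose F t x := p (x + t *: y) - t * p y.
have [|x|s t s0 t0|s t s0 t0|t t0|sq qF] :=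
    @inf_sublinear R [set t | 0 <= t] F.
- by exists 0 => /=.
- exists (- p (- x)) => t t0; rewrite /F -pZ// lerBrDr addrC lerBlDr.
  by rewrite (le_trans _ (pD _ _))// addrC addrA addNr add0r.
- exists (s + t); first exact: addr_ge0.
  move=> u v; rewrite /F scalerDl (addrACA u) mulrDl opprD [leRHS]addrACA.
  by rewrite lerD2r.
- exists (s * t); first by rewrite /= mulr_ge0// ltW.
  by move=> x; rewrite /F -scalerA -scalerDr pZ ?(ltW s0)// mulrBr mulrA.
- by rewrite /F add0r pZ// subrr.
exists (fun x => inf [set F i x | i in [set t | 0 <= t]]); split=> //.
  by move=> x; rewrite (le_trans (qF 0 _ _))//= /F scale0r addr0 mul0r subr0.
rewrite (le_trans (qF 1 _ _))//= /F scale1r addNr mul1r.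
by rewrite (sublinear0 sp) sub0r.
Qed.

(** Zorn's lemma for the reversed pointwise order. The infimum of a chain is finite because every
    sublinear map below [p] lies above [x |-> - p (- x)]. *)
Lemma minimal_sublinear p : sublinear p ->
  exists q, [/\ sublinear q, forall x, q x <= p x &
    forall r, sublinear r -> (forall x, r x <= q x) -> r = q].
Proof.
move=> sp; pose T := {q | sublinear q /\ forall x, q x <= p x}.
pose le (q r : T) := `[< forall x, sval r x <= sval q x >].
have [||||[q [sq qp]] qmin] := @Zorn T le.
- by move=> q; apply/asboolP => x.
- move=> q r s /asboolP qr /asboolP rs; apply/asboolP => x.
  exact: le_trans (rs x) (qr x).
- move=> [q hq] [r hr] /asboolP /= qr /asboolP /= rq; apply: eq_exist => /=.
  by apply/funext => x; apply/eqP; rewrite eq_le qr rq.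
- move=> A totA; have [[a Aa]|A0] := pselect (A !=set0); last first.
    exists (exist _ p (conj sp (fun=> lexx _))) => s As.
    by exfalso; apply: A0; exists s.
  have [|x|q r Aq Ar|t q t0 Aq|q Aq|sq qF] :=
      @inf_sublinear T A (fun s => sval s).
  - by exists a.
  - exists (- p (- x)) => -[q [sq qp]] _ /=.
    by rewrite (le_trans _ (sublinearN x sq))// lerN2.
  - have [/asboolP qr|/asboolP rq] := totA _ _ Aq Ar.
      exists r => // x y; rewrite (le_trans ((proj2_sig r).1.1 _ _))//.
      by rewrite lerD2r.
    exists q => // x y; rewrite (le_trans ((proj2_sig q).1.1 _ _))//.
    by rewrite lerD2l.
  - by exists q => // x; rewrite (proj2_sig q).1.2// ltW.
  - by rewrite (sublinear0 (proj2_sig q).1).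
  have qp x : inf [set sval i x | i in A] <= p x.
    by rewrite (le_trans (qF a x Aa))//; exact: (proj2_sig a).2.
  exists (exist (fun q => sublinear q /\ forall x, q x <= p x) _ (conj sq qp)).
  by move=> s As; apply/asboolP => x /=; exact: qF.
exists q; split=> // r sr rq.
have rp x : r x <= p x := le_trans (rq x) (qp x).
have /(_ _)/(congr1 sval) := qmin (exist _ r (conj sr rp)).
by apply; apply/asboolP.
Qed.

(* A minimal sublinear q is odd, because the shift of q along y lies below q
   and takes a value at most - q y at - y; an odd sublinear map is linear. *)
Theorem hahn_banach p x0 : sublinear p ->
  exists f, [/\ scalar f, forall x, f x <= p x & p x0 <= f x0].
Proof.
(* Shifting along [x0] before minimizing forces [f (- x0) <= - p x0], which becomes the lower bound
   at [x0] once [f] is odd. *)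
move=> sp; have [p' [sp' p'p p'x0]] := sublinear_shift x0 sp.
have [f [sf fp' fmin]] := minimal_sublinear sp'.
have fN x : f (- x) = - f x.
  have [g [sg gf gx]] := sublinear_shift x sf.
  rewrite (fmin _ sg gf) in gx.
  by apply/le_anti; rewrite gx lerNl sublinearN.
have [fD fZ] := sf; exists f; split.
- have fD' x y : f (x + y) = f x + f y.
    apply/eqP; rewrite eq_le fD/= -lerN2 -fN opprD opprD -!fN; exact: fD.
  move=> a x y; rewrite fD'; congr (_ + _).
  have [a0|/ltW a0] := leP 0 a; first exact: fZ.
  by rewrite -[a]opprK scaleNr fN fZ ?oppr_ge0// -mulNr.
- by move=> x; exact: le_trans (fp' x) (p'p x).
- by rewrite -lerN2 -fN (le_trans (fp' _)).
Qed.

End HahnBanach.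

(** * Subsequences and duality *)

Section Subsequences.
Implicit Types k : nat -> nat.

Lemma increasing_seq_ge k n : increasing_seq k -> (n <= k n)%N.
Proof.
move=> /increasing_seqP ki; elim: n => // n IH.
exact: leq_ltn_trans IH (ki n).
Qed.

Lemma cvg_increasing_seq k : increasing_seq k -> k @ \oo --> \oo.
Proof.
move=> ki A [N _ NA]; exists N => // n /= Nn; apply: NA => /=.
exact: leq_trans Nn (increasing_seq_ge n ki).
Qed.

Lemma increasing_seq_comp k j :
  increasing_seq k -> increasing_seq j -> increasing_seq (k \o j).
Proof. by move=> ki ji m n /=; rewrite ki -leEnat ji. Qed.

(** The property may depend on the index [j], which allows diagonal choices with errors shrinking in
    [j]. *)
Lemma subseq_choice (P : nat -> nat -> Prop) :
  (forall j N, exists2 n, (N <= n)%N & P j n) ->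
  exists2 k, increasing_seq k & forall j, P j (k j).
Proof.
move=> hP; have /choice[f fP] (jN : nat * nat) : exists n,
  (jN.2 <= n)%N /\ P jN.1 n by have [n] := hP jN.1 jN.2; exists n.
pose fix k j := if j is i.+1 then f (j, (k i).+1) else f (0%N, 0%N).
exists k.
  by apply/increasing_seqP => n; case: (fP (n.+1, (k n).+1)).
by case=> [|j]; [case: (fP (0%N, 0%N))|case: (fP (j.+1, (k j).+1))].
Qed.

Lemma not_near_subseq (A : set nat) : ~ (\forall n \near \oo, A n) ->
  exists2 k, increasing_seq k & forall j, ~ A (k j).
Proof.
move=> nA; apply: (@subseq_choice (fun _ n => ~ A n)) => _ N.
apply: contrapT => h; apply: nA; exists N => // n /= Nn.
by apply: contrapT => An; apply: h; exists n.
Qed.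

Lemma cvg_subseq (T : topologicalType) (x : nat -> T) (l : T) :
  (forall k, increasing_seq k ->
    exists2 j, increasing_seq j & (x \o k \o j) @ \oo --> l) ->
  x @ \oo --> l.
Proof.
move=> sub A lA; apply: contrapT => /not_near_subseq[k /sub[j _ jl] kA].
have [N _ /(_ N (leqnn N))] := jl A lA; exact: kA.
Qed.

(* Hypotheses on the n-th data that quantify over full sequences are applied to a
   subsequence by replacing the terms outside it with the limit l. *)
Definition subseq_ext (T : Type) k (l : T) (x : nat -> T) n :=
  if `[< exists j, k j = n >] then x n else l.

Lemma subseq_extE (T : Type) k (l : T) x j : subseq_ext k l x (k j) = x (k j).
Proof. by rewrite /subseq_ext; case: asboolP => // -[]; exists j. Qed.

Lemma cvg_subseq_ext (T : topologicalType) k (l : T) (x : nat -> T) :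
  increasing_seq k -> (x \o k) @ \oo --> l -> subseq_ext k l x @ \oo --> l.
Proof.
move=> ki xl A lA; have [N _ NA] := xl A lA.
exists (k N) => // n /= kn; rewrite /subseq_ext; case: asboolP => [[j jn]|_].
  by rewrite -jn; apply: NA => /=; rewrite -ki leEnat jn.
exact: nbhs_singleton.
Qed.

End Subsequences.

Lemma dual_ofP (R : realType) (V : normedModType R) (f : V -> R) (M : R) :
  scalar f ->
  (forall x, `|f x| <= M * `|x|) -> exists g : dual V, g =1 f.
Proof.
move=> lf fM.
pose F : {linear V -> R^o} := HB.pack f (GRing.isLinear.Build _ _ _ _ _ lf).
have cf : continuous f.
  have : bounded_near F (nbhs 0).
    apply/linear_boundedP; near=> r => x; rewrite (le_trans (fM x))//.
    by rewrite ler_wpM2r.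
  by move=> /linear_bounded_continuous.
have fd : f \in @is_dual R V by apply/asboolP; split.
by exists (Dual fd).
Unshelve. all: by end_near. Qed.

Section Duality.
Context (R : realType) (V : normedModType R).
Implicit Types (f : dual V) (x : V).

Lemma dual_bounded f : exists2 M : R, 0 <= M & forall x, `|f x| <= M * `|x|.
Proof.
have /linear_bounded_continuous/linear_boundedP := @pairing_continuous _ _ f.
move=> /pinfty_ex_gt0[M M0 fM]; exists M => //; exact: ltW.
Qed.

Lemma le_dual_norm f x : `|f x| <= `|f| * `|x|.
Proof.
have [->|x0] := eqVneq x 0; first by rewrite linear0 normr0 normr0 mulr0.
rewrite -ler_pdivrMr ?normr_gt0// dual_normE; apply: ub_le_sup.
  have [M M0 fM] := dual_bounded f; exists M => _ [y /= y1 <-].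
  by rewrite (le_trans (fM y))// ler_piMr.
exists (`|x|^-1 *: x); rewrite /= ?linearZ/= ?normrZ normfV normr_id.
  by rewrite mulVf ?normr_eq0.
by rewrite mulrC.
Qed.

Lemma evalP x : exists phi : dual (dual V), forall f, phi f = f x.
Proof.
by have [|f|phi] := @dual_ofP _ (dual V) (fun f => f x) `|x|;
  [|rewrite mulrC; exact: le_dual_norm|exists phi].
Qed.

End Duality.

(** * Weak sequential compactness in reflexive spaces *)

Lemma cvgr_le_bound (R : realType) (T : Type) (F : set_system T)
    {FF : ProperFilter F} (u : T -> R) (l c : R) :
  u @ F --> l -> (forall t, u t <= c) -> l <= c.
Proof.
move=> ul uc; rewrite -(cvg_lim (@Rhausdorff R) ul).
apply: limr_le; first by apply/cvg_ex; exists l.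
exact: filterE.
Qed.

Section WeakCompactness.
Context (R : realType) (V : normedModType R).

(* The limits along U of f (x t), for f in V', form an element of V''. *)
Lemma reflexive_ultra_cvg (T : Type) (U : set_system T) (x : T -> V) (B : R) :
  reflexive_space V -> UltraFilter U -> (forall t, `|x t| <= B) ->
  exists l, forall f : dual V, f (x t) @[t --> U] --> f l.
Proof.
move=> Vrefl UU xB.
have /choice[phi phiE] (f : dual V) : exists r : R, f (x t) @[t --> U] --> r.
  pose C := `|f| * B.
  have fxC : \forall t \near U, `[- C, C]%classic (f (x t)).
    apply: filterE => t /=; rewrite in_itv/= -ler_norml.
    by rewrite (le_trans (le_dual_norm _ _))// ler_wpM2l.
  have [r [_ rf]] := @segment_compact R (- C) C (fmap (fun t => f (x t)) U) _ fxC.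
  (* A cluster point of the image of an ultrafilter is its limit: otherwise the complement of some
     neighbourhood of [r] would belong to the image, yet miss that neighbourhood. *)
  exists r => A rA /=.
  have [//|UAC] := in_ultra_setVsetC (fun t => A (f (x t))) UU.
  by have [s []] := rf (~` A) A UAC rA.
have phi_scalar : scalar phi.
  move=> a f g; apply: cvg_unique (phiE _) _; first exact: Rhausdorff.
  rewrite (_ : (fun t => _) = fun t => a * f (x t) + g (x t)); last by [].
  have af : a * f (x t) @[t --> U] --> a * phi f by apply: cvgMl_tmp; exact: phiE.
  exact: cvgD af (phiE g).
have phi_bound f : `|phi f| <= B * `|f|.
  apply: (cvgr_le_bound (cvg_norm (phiE f))) => t.
  rewrite (le_trans (le_dual_norm _ _))// mulrC.
  by rewrite ler_wpM2r.
have [Phi PhiE] := dual_ofP phi_scalar phi_bound.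
by have [l lE] := Vrefl Phi; exists l => f; rewrite -lE PhiE.
Qed.

Variable x : nat -> V.
Implicit Types (p : {poly R}) (v w : V).

(** Polynomials serve as finitely supported coefficient sequences; those with rational coefficients
    are countable. *)
Definition lincomb (p : {poly R}) : V := \sum_(i < size p) p`_i *: x i.

Lemma lincomb_widen n p : (size p <= n)%N -> lincomb p = \sum_(i < n) p`_i *: x i.
Proof.
move=> pn; rewrite /lincomb (big_ord_widen n (fun i => p`_i *: x i))//.
rewrite big_mkcond/=; apply: eq_bigr => i _.
by case: ltnP => // /(nth_default _) ->; rewrite scale0r.
Qed.

Lemma lincombD p q : lincomb (p + q) = lincomb p + lincomb q.
Proof.
pose n := maxn (size p) (size q).
rewrite !(@lincomb_widen n) ?size_polyD ?leq_maxl ?leq_maxr//.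
by rewrite -big_split/=; apply: eq_bigr => i _; rewrite coefD scalerDl.
Qed.

Lemma lincombZ a p : lincomb (a *: p) = a *: lincomb p.
Proof.
rewrite !(@lincomb_widen (size p)) ?size_scale_leq// scaler_sumr.
by apply: eq_bigr => i _; rewrite coefZ scalerA.
Qed.

Lemma lincombXn n : lincomb 'X^n = x n.
Proof.
rewrite /lincomb size_polyXn big_ord_recr/= coefXn eqxx scale1r.
rewrite big1 ?add0r// => i _.
by rewrite coefXn ltn_eqF ?scale0r.
Qed.

(** This is the norm closure of the linear span of the [x n]. *)
Definition in_span (v : V) := forall e, 0 < e -> exists p, `|v - lincomb p| < e.

Lemma in_spanB v w : in_span v -> in_span w -> in_span (v - w).
Proof.
move=> vs ws e e0; have e2 : 0 < e / 2 by rewrite divr_gt0.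
have [p pv] := vs _ e2; have [q qw] := ws _ e2.
exists (p + (- 1) *: q); rewrite lincombD lincombZ scaleN1r opprD addrACA.
by rewrite -opprD (le_lt_trans (ler_normB _ _))// [e]splitr ltrD.
Qed.

(* Hahn-Banach for the distance to the span gives a functional that vanishes
   on the x n and is at least that distance at l. *)
Lemma weak_cluster_in_span (F : set_system nat) (l : V) : ProperFilter F ->
  (forall f : dual V, f (x n) @[n --> F] --> f l) -> in_span l.
Proof.
move=> FF xl; pose dist (p : {poly R}) v := `|v - lincomb p|.
have [|v|p q _ _|t p t0 _|p _|sub_d d_le] :=
  @inf_sublinear R V {poly R} setT dist.
- by exists 0.
- by exists 0 => p _; exact: normr_ge0.
- exists (p + q) => // v w; rewrite /dist lincombD opprD addrACA.
  exact: ler_normD.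
- exists (t *: p) => // v; rewrite /dist lincombZ -scalerBr normrZ.
  by rewrite gtr0_norm.
- exact: normr_ge0.
have [f [f_scalar f_le f_l]] := hahn_banach l sub_d.
have f_norm v : f v <= `|v|.
  rewrite (le_trans (f_le v))// (le_trans (d_le 0 v _))//.
  by rewrite /dist /lincomb size_poly0 big_ord0 subr0.
pose fl : {scalar V} := HB.pack f (GRing.isLinear.Build _ _ _ _ _ f_scalar).
have fN v : f (- v) = - f v := linearN fl v.
have [v|g gE] := @dual_ofP _ V f 1 f_scalar.
  by rewrite mul1r ler_norml f_norm andbT lerNl -fN -(normrN v) f_norm.
have fx n : f (x n) <= 0.
  rewrite (le_trans (f_le _))// (le_trans (d_le 'X^n _ _))//.
  by rewrite /dist lincombXn subrr normr0.
have fl0 : f l <= 0.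
  by rewrite -gE; apply: (cvgr_le_bound (xl g)) => n; rewrite gE.
move=> e e0; have [||_ [p _ <-] pe] := @inf_lt R [set dist p l | p in setT] e.
- by exists (dist 0 l), 0.
- by rewrite (le_lt_trans f_l)// (le_lt_trans fl0).
by exists p.
Qed.

Lemma lincomb_ratr (B : R) (p : {poly R}) e : (forall n, `|x n| <= B) -> 0 < e ->
  exists q : {poly rat}, `|lincomb p - lincomb (map_poly ratr q)| < e.
Proof.
move=> xB e0; pose n := size p.
have B0 : 0 <= B by exact: le_trans (xB 0%N).
have C0 : 0 < n%:R * B + 1 by rewrite ltr_wpDl// mulr_ge0.
(* Each of the [n] terms contributes an error of at most [d * B]; the summand 1 keeps the
   denominator positive and the total strictly below [e]. *)
pose d := e / (n%:R * B + 1).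
have d0 : 0 < d by rewrite divr_gt0.
have /choice[r rP] (i : nat) : exists r : rat, `|p`_i - ratr r| <= d.
  have [|r] := @rat_in_itvoo R (p`_i - d) (p`_i + d).
    by rewrite ltrBlDr -addrA ltrDl addr_gt0.
  rewrite in_itv/= -ltr_distl distrC => /ltW ?; by exists r.
exists (\poly_(i < n) r i).
rewrite !(@lincomb_widen n)//; last first.
  by rewrite (leq_trans (size_poly _ _))// size_poly.
rewrite -sumrB (le_lt_trans (ler_norm_sum _ _ _))//.
apply: (@le_lt_trans _ _ (\sum_(i < n) d * B)).
  apply: ler_sum => i _; rewrite -scalerBl normrZ coef_map coef_poly ltn_ord/=.
  exact: ler_pM.
rewrite sumr_const card_ord -mulr_natl mulrCA /d mulrAC ltr_pdivrMr//.
by rewrite ltr_pM2l// ltrDl.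
Qed.

Lemma norming_functional (v : V) :
  exists g : dual V, (forall w, g w <= `|w|) /\ `|v| <= g v.
Proof.
have sn : sublinear (fun v : V => `|v|).
  by split=> [|t w t0]; [exact: ler_normD|rewrite normrZ ger0_norm].
have [f [f_scalar f_le f_v]] := hahn_banach v sn.
pose fl : {scalar V} := HB.pack f (GRing.isLinear.Build _ _ _ _ _ f_scalar).
have fN w : f (- w) = - f w := linearN fl w.
have [w|g gE] := @dual_ofP _ V f 1 f_scalar.
  by rewrite mul1r ler_norml f_le andbT lerNl -fN -(normrN w) f_le.
by exists g; split=> [w|]; rewrite gE.
Qed.

(* Norming functionals of the rational combinations of the x n separate the
   points of the closed span. *)
Lemma separating_functionals (B : R) : (forall n, `|x n| <= B) ->
  exists g : nat -> dual V, forall v w, in_span v -> in_span w ->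
    (forall i, g i v = g i w) -> v = w.
Proof.
(* [d] enumerates the rational combinations; an index that codes no polynomial yields the zero
   combination. *)
move=> xB; pose d (i : nat) : V := lincomb (map_poly ratr (odflt 0 (unpickle i))).
have /choice[g gP] i := norming_functional (d i); exists g => v w vs ws gvw.
apply/eqP; rewrite -subr_eq0 -normr_le0.
apply/ler_addgt0Pl => e e0; rewrite addr0.
have e4 : 0 < e / 4 by rewrite divr_gt0.
have [p pe] := in_spanB vs ws e4.
have [q qe] := lincomb_ratr p xB e4.
have dE : d (pickle q) = lincomb (map_poly ratr q) by rewrite /d pickleK.
have {pe qe} vw : `|(v - w) - d (pickle q)| < e / 2.
  rewrite dE -(subrK (lincomb p) (v - w)) -addrA.
  rewrite (le_lt_trans (ler_normD _ _))//; lra.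
have [gn gd] := gP (pickle q).
(* The functional vanishes at [v - w] and norms [d (pickle q)], so the norm of [d (pickle q)] is at
   most its distance to [v - w], which is below [e / 2]. *)
have := gn (d (pickle q) - (v - w)); rewrite distrC.
rewrite !linearB/= gvw subrr addr0 => /(le_trans gd) dvw.
rewrite -(subrK (d (pickle q)) (v - w)) (le_trans (ler_normD _ _))//.
lra.
Qed.

(** The limit [l] along one ultrafilter is the candidate. If some [f] failed to converge along the
    chosen subsequence, an ultrafilter on the bad indices would give a limit [l'] on which all
    separating functionals agree with [l]; then [l' = l], a contradiction. *)
Theorem weak_seq_compact (B : R) : reflexive_space V -> (forall n, `|x n| <= B) ->
  exists k l, increasing_seq k /\ weak_cvg (x \o k) l.
Proof.
move=> Vrefl xB; have [g g_sep] := separating_functionals xB.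
have [U [UU oU]] := ultraFilterLemma eventually_filter.
have [l xl] := reflexive_ultra_cvg Vrefl UU xB.
have l_span : in_span l by exact: weak_cluster_in_span xl.
(* At stage [j] the first [j + 1] functionals are within [1 / (j + 1)] of their values at [l], so
   each of them converges along [k]. *)
have [j N|k ki kP] := @subseq_choice
    (fun j n => forall i : 'I_j.+1, `|g i l - g i (x n)| < j.+1%:R^-1).
  have : \forall n \near U, (N <= n)%N /\
      forall i : 'I_j.+1, `|g i l - g i (x n)| < j.+1%:R^-1.
    apply: filterI; first by apply: oU; exists N.
    apply: filter_forall => i.
    by have /cvgrPdist_lt := xl (g i); apply; rewrite invr_gt0.
  by move=> /filter_ex[n [Nn nP]]; exists n.
have gk i : g i (x (k j)) @[j --> \oo] --> g i l.
  apply/cvgrPdist_lt => e e0; near=> j.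
  have ij : (i < j.+1)%N by rewrite ltnS; near: j; exists i.
  rewrite (lt_trans (kP j (Ordinal ij)))//.
  near: j; exact: (near_infty_natSinv_lt (PosNum e0)).
exists k, l; split=> //; apply/weak_cvgP => f; apply: contrapT => nfl.
pose good e := fun j => `|f l - f (x (k j))| < e.
have [e e0 ne] : exists2 e, 0 < e & ~ (\forall j \near \oo, good e j).
  apply: contrapT => h; apply: nfl; apply/cvgrPdist_lt => e e0.
  by apply: contrapT => ne; apply: h; exists e.
(* The tails restricted to the bad indices form a proper filter because the good indices are not
   eventual. *)
have wF : ProperFilter (within (~` good e) \oo).
  apply: Build_ProperFilter => h; apply: ne.
  apply: (@filterS _ \oo _ _ _ _ h) => j {}h.
  by apply: contrapT => /h.
have [W [WW oW]] := ultraFilterLemma wF.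
have WP : W --> \oo by move=> A oA; apply: oW; apply: filterS oA => j Aj _.
have [l' xl'] := reflexive_ultra_cvg Vrefl WW (fun j => xB (k j)).
have l'_span : in_span l'.
  apply: (@weak_cluster_in_span (fmap k W)) => h; exact: xl'.
have ll' : l = l'.
  apply: g_sep => // i; apply: cvg_unique (xl' (g i)); first exact: Rhausdorff.
  exact: cvg_trans (cvg_app _ WP) (gk i).
have : W (good e) by have /cvgrPdist_lt/(_ _ e0) := xl' f; rewrite -ll'.
have : W (~` good e) by apply: oW; apply: (@filterE _ \oo).
by move=> Wn Wg; have [j []] := filter_ex (filterI Wn Wg).
Unshelve. all: by end_near. Qed.

End WeakCompactness.

(** * The mixed problem *)

Section Limits.
Context (R : realType).

(** The upper-limit hypotheses on the [J] and [b] terms enter in this form, which keeps the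
    estimates in the reals. *)
Lemma limn_esup_near (a : nat -> R) (l e : R) :
  (limn_esup (fun n => (a n)%:E) <= l%:E)%E -> 0 < e ->
  \forall n \near \oo, a n < l + e.
Proof.
move=> al e0.
have : (limn_esup (fun n => (a n)%:E) < (l + e)%:E)%E.
  by rewrite (le_lt_trans al)// lte_fin ltrDl.
rewrite /limn_esup limf_esupE => /ereal_inf_lt[_ [A oA <-] supA].
apply: filterS oA => n An; rewrite -lte_fin (le_lt_trans _ supA)//.
by apply: ereal_sup_ubound; exists n.
Qed.

Lemma near_bounded (a : nat -> R) (B : R) :
  (\forall n \near \oo, a n <= B) -> exists C, forall n, a n <= C.
Proof.
move=> [N _ aB]; exists (`|B| + \sum_(i < N) `|a i|) => n.
have [Nn|nN] := leqP N n.
  rewrite (le_trans (aB n Nn))// (le_trans (ler_norm _))// lerDl.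
  exact: sumr_ge0.
rewrite (le_trans (ler_norm _))// -[leLHS]add0r lerD//.
by rewrite (bigD1 (Ordinal nN))//= lerDl sumr_ge0.
Qed.

(** Uniform boundedness principle, by completeness of [V]: convergent real sequences are bounded at
    each point. *)
Lemma pointwise_cvg_bounded (V : completeNormedModType R) (f : nat -> dual V)
    (l : V -> R) :
  (forall v, f n v @[n --> \oo] --> l v) ->
  exists2 B, 0 <= B & forall n, `|f n| <= B.
Proof.
move=> fl; pose F : set (V -> R^o) := range (fun n => (f n : V -> R^o)).
have [_ [n _ <-]|v|B fB] := @Banach_Steinhauss R V R^o F _ _ 1.
- split; last exact: pairing_scalar.
  move=> r; exists (`|f n| * r) => x xr.
  by rewrite (le_trans (le_dual_norm _ _))// ler_wpM2l.
- have [B [_ /(_ (B + 1))]] := cvg_seq_bounded (cvgP _ (fl v)).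
  rewrite ltrDl => /(_ ltr01) fB; exists (B + 1) => _ [n _ <-].
  exact: fB.
have B0 : 0 <= B.
  rewrite (le_trans (normr_ge0 (f 0%N 0)))//.
  by apply: fB; [exists 0%N|rewrite normr0].
exists B => // n; rewrite dual_normE; apply: ge_sup.
  by exists `|f n 0|, 0 => //=; rewrite normr0.
by move=> _ [x /= x1 <-]; apply: fB x1; exists n.
Qed.

(** Write [f n (x n)] as [f n (x n - l) + f n l]; the norms of the [f n] are bounded, so the first
    term vanishes in the limit. *)
Lemma cvg_pairing (V : completeNormedModType R) (f : nat -> dual V)
    (g : dual V) (x : nat -> V) (l : V) :
  (forall v, f n v @[n --> \oo] --> g v) -> x @ \oo --> l ->
  f n (x n) @[n --> \oo] --> g l.
Proof.
move=> fg xl; have [B B0 fB] := pointwise_cvg_bounded fg.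
rewrite (_ : (fun n => _) = fun n => f n (x n - l) + f n l); last first.
  by apply/funext => n; rewrite linearB/= subrK.
rewrite -[X in _ --> X]add0r; apply: cvgD (fg l).
apply/cvgrPdist_lt => e e0.
have B1 : 0 < B + 1 by rewrite ltr_wpDl.
have /cvgrPdist_lt/(_ (e / (B + 1)) ltac:(by rewrite divr_gt0)) := xl.
apply: filterS => n; rewrite ltr_pdivlMr// sub0r normrN distrC => xe.
rewrite (le_lt_trans (le_dual_norm _ _))// (le_lt_trans _ xe)// mulrC.
by rewrite ler_wpM2l// (le_trans (fB n))// lerDl.
Qed.

Lemma weak_cvg_eval (V : normedModType R) (f : nat -> dual V) (g : dual V) :
  weak_cvg f g -> forall v, f n v @[n --> \oo] --> g v.
Proof.
move=> /weak_cvgP fg v; have [phi phiE] := evalP v.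
by have := fg phi; rewrite phiE; under eq_fun do rewrite phiE.
Qed.

Lemma cvg_dual_eval (V : normedModType R) (f : nat -> dual V) (g : dual V) :
  f @ \oo --> g -> forall v, f n v @[n --> \oo] --> g v.
Proof.
move=> fg v; apply/cvgrPdist_lt => e e0.
have v1 : 0 < `|v| + 1 by rewrite ltr_wpDl.
have /cvgrPdist_lt/(_ (e / (`|v| + 1)) ltac:(by rewrite divr_gt0)) := fg.
apply: filterS => n; rewrite ltr_pdivlMr// => fe.
rewrite -[_ - _]/((g - f n) v) (le_lt_trans (le_dual_norm _ _))//.
by rewrite (le_lt_trans _ fe)// ler_wpM2l// lerDl.
Qed.

End Limits.

(** * Uniqueness for the mixed problem *)

Section MixedProblem.
Context (R : realType) (X Y Z : normedModType R).
Context (D : mixed_data X Y Z) (K : constants X) (DK : admissible D K).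
Local Notation b := (formb D).

Lemma formbBl v w mu : b (v - w) mu = b v mu - b w mu.
Proof.
by rewrite addrC -scaleN1r (b_bilinear DK).1 /= mulN1r addrC.
Qed.

Lemma formbBr v mu nu : b v (mu - nu) = b v mu - b v nu.
Proof.
by rewrite addrC -scaleN1r (b_bilinear DK).2 /= mulN1r addrC.
Qed.

Lemma formb0l mu : b 0 mu = 0.
Proof. by rewrite -(subrr 0) formbBl subrr. Qed.

Lemma formbNl v mu : b (- v) mu = - b v mu.
Proof. by rewrite -sub0r formbBl formb0l sub0r. Qed.

Lemma funJ_le u v : funJ D u v <= cc K * `|v|.
Proof. exact: le_trans (ler_norm _) (J_bounded DK _ _). Qed.

Lemma funJ0 u : funJ D u 0 = 0.
Proof.
by apply/eqP; rewrite -normr_le0 (le_trans (J_bounded DK _ _))// normr0 mulr0.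
Qed.

(** Every quotient in the inf-sup condition at [mu] is at most [C] divided by the norm of [mu]. *)
Lemma inf_sup_norm_le (mu : Y) (C : R) : 0 <= C ->
  (forall v, b v mu <= C * `|v|) -> calpha K * `|mu| <= C.
Proof.
move=> C0 bC; have [->|mu0] := eqVneq mu 0; first by rewrite normr0 mulr0.
have mu_gt0 : 0 < `|mu| by rewrite normr_gt0.
rewrite -ler_pdivlMr// -lee_fin (le_trans (b_inf_sup DK))//.
apply: (@le_trans _ _ (ereal_sup [set (b v mu / (`|v| * `|mu|))%:E
    | v in [set v : X | v != 0]])); first by apply: ereal_inf_lbound; exists mu.
apply: ge_ereal_sup => _ [v /= v0 <-].
rewrite lee_fin invfM mulrA ler_wpM2r ?invr_ge0//.
by rewrite ler_pdivrMr ?normr_gt0.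
Qed.

Lemma opA_strongly_monotone u v :
  cM K * `|v - u| `^ cq K <= opA D v (v - u) - opA D u (v - u).
Proof.
exact: le_trans (h_lower_bound DK _) (A_h_monotone DK _ _).
Qed.

(** Testing each inequality with the other solution and adding leaves [M - m] times a power of the
    distance of [u1] and [u2], bounded by 0. *)
Lemma mixed_solution_unique (pi : {linear X -> Z}) u1 l1 u2 l2 :
  mixed_solution pi D u1 l1 -> mixed_solution pi D u2 l2 ->
  u1 = u2 /\ l1 = l2.
Proof.
move=> [L1 eq1 in1] [L2 eq2 in2].
have u12 : u1 = u2.
  have := eq1 u2; have := eq2 u1; have := in1 _ L2; have := in2 _ L1.
  rewrite -(opprB u1 u2) !linearN/= formbNl !formbBl !formbBr opprB.
  have := opA_strongly_monotone u2 u1.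
  have := J_relaxed_monotone DK u1 u2.
  set N := `|u1 - u2| `^ _ => JN AN b2 b1 h2 h1.
  have N0 : (cM K - cm K) * N <= 0 by lra.
  apply: contrapT => /eqP; rewrite -subr_eq0 -normr_gt0.
  move=> /(@powR_gt0 _ _ (cq K)).
  rewrite -/N ltNge; move: N0.
  by rewrite pmulr_rle0 ?subr_gt0 ?(m_lt_M DK)// => ->.
split=> //; subst u2; apply/eqP; rewrite -subr_eq0 -normr_le0.
rewrite -(pmulr_rle0 _ (alpha_gt0 DK)).
apply: inf_sup_norm_le => // v; rewrite mul0r formbBr.
(* These opposite tests cancel [A] and [f], and [J_opposite] removes [J]: what remains is
   [b v (l1 - l2) <= 0], and the inf-sup bound applies with [C = 0]. *)
have := eq1 (u1 - v); have := eq2 (u1 + v).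
rewrite !(addrAC u1 _ (- u1)) !subrr !add0r !linearN/= formbNl.
by have := J_opposite DK u1 v; lra.
Qed.

End MixedProblem.

(** * A priori estimates for a solution *)

Section Estimates.
Context (R : realType) (X Y Z : normedModType R).
Context (D : mixed_data X Y Z) (K : constants X) (DK : admissible D K).
Context (pi : {linear X -> Z}) (u : X) (lambda : Y).
Context (u_sol : mixed_solution pi D u lambda).

Lemma solution_energy_le : opA D u u <= rhsf D (pi u) + cc K * `|u|.
Proof.
have [_ /(_ 0) + /(_ _ (Lambda_zero DK))] := u_sol.
rewrite (formbBr DK) !sub0r !linearN/= (formbNl DK).
have := funJ_le DK u (- u); rewrite normrN.
have -> : formb D u 0 = 0 by rewrite -(subrr 0) (formbBr DK) subrr.
by lra.
Qed.

(** Testing with [u - w] isolates [b w lambda] and bounds it linearly in [w], so the inf-sup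
    condition applies. *)
Lemma solution_multiplier_le (C : R) : 0 <= C ->
  (forall w, rhsf D (pi w) <= C * `|w|) ->
  calpha K * `|lambda| <= C + `|opA D u| + cc K.
Proof.
move=> C0 fC; have [_ eq _] := u_sol.
apply: (inf_sup_norm_le DK) => [|w].
  by rewrite !addr_ge0// ltW// (c_gt0 DK).
have := eq (u - w); rewrite addrAC subrr sub0r !linearN/= (formbNl DK).
have := funJ_le DK u (- w); rewrite normrN.
have := fC w; have := le_dual_norm (opA D u) w; rewrite ler_norml => /andP[+ _].
by rewrite !mulrDl; lra.
Qed.

End Estimates.

Lemma powR_ge_sqr (R : realType) (t q : R) : 1 <= t -> 2 <= q -> t ^+ 2 <= t `^ q.
Proof.
by move=> t1 q2; rewrite -powR_mulrn ?(le_trans _ t1)// ler_powR.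
Qed.

(** * Uniform bounds for the perturbed solutions *)

Section Stability.
Context (R : realType) (X Y Z : completeNormedModType R).
Context (pi : {linear X -> Z}) (pi_continuous : continuous pi).
Context (pi_completely_continuous : forall (v : nat -> X) (v0 : X),
  weak_cvg v v0 -> pi (v n) @[n --> \oo] --> pi v0).
Context (D : mixed_data X Y Z) (K : constants X) (DK : admissible D K).
Context (Dn : nat -> mixed_data X Y Z) (Kn : nat -> constants X).
Context (DKn : forall n, admissible (Dn n) (Kn n)).
Context (un : nat -> X) (lambdan : nat -> Y).
Context (un_sol : forall n, mixed_solution pi (Dn n) (un n) (lambdan n)).
Context (F delta : nat -> R) (delta_tilde : R).
Context (F_ge0 : forall n, 0 <= F n) (delta_ge0 : forall n, 0 <= delta n).
Context (opA_dist : forall n (v : X),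
  `|opA (Dn n) v - opA D v| <= F n * (`|v| + delta n)).
Context (F_cvg0 : F @ \oo --> (0 : R)).
Context (delta_le : forall n, delta n <= delta_tilde).
Context (f_cvg : weak_cvg (fun n => rhsf (Dn n)) (rhsf D)).

Lemma rhs_bounded : exists2 C, 0 <= C &
  forall n w, `|rhsf (Dn n) (pi w)| <= C * `|w|.
Proof.
have [B B0 fB] := pointwise_cvg_bounded (weak_cvg_eval f_cvg).
have /linear_bounded_continuous/linear_boundedP/pinfty_ex_gt0[P P0 piP] :=
  pi_continuous.
exists (B * P) => [|n w]; first by rewrite mulr_ge0// ltW.
rewrite (le_trans (le_dual_norm _ _))// -mulrA.
by apply: ler_pM => //; exact: piP.
Qed.

Lemma F_eventually_le e : 0 < e -> \forall n \near \oo, F n <= e.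
Proof.
move=> e0; have /cvgrPdist_lt/(_ _ e0) := F_cvg0; apply: filterS => n.
by rewrite sub0r normrN ger0_norm// => /ltW.
Qed.

Lemma opA_dist_le n v w :
  `|opA (Dn n) v w - opA D v w| <= F n * (`|v| + delta_tilde) * `|w|.
Proof.
rewrite -[X in `|X|]/((opA (Dn n) v - opA D v) w).
rewrite (le_trans (le_dual_norm _ _))// ler_wpM2r//.
by rewrite (le_trans (opA_dist _ _))// ler_wpM2l// lerD2l.
Qed.

(* The perturbation term F n * |un n|^2 is absorbed by the coercive term since
   the exponent q is at least 2. *)
Lemma solutions_bounded (c_tilde : R) : (forall n, cc (Kn n) <= c_tilde) ->
  exists2 B, 0 <= B & forall n, `|un n| <= B.
Proof.
move=> c_le; have [C C0 fC] := rhs_bounded.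
have M0 := M_gt0 DK; have d0 := le_trans (delta_ge0 0%N) (delta_le 0%N).
(* Once [F n <= M / 2] and the norm [t] of [un n] is at least 1, the energy estimate reads
   [M * t^2 <= E * t + (M / 2) * t^2]. *)
pose E := C + c_tilde + `|opA D 0| + cM K / 2 * delta_tilde.
have [|B uB] := @near_bounded R (fun n => `|un n|) (Num.max 1 (E / (cM K / 2))).
  have := F_eventually_le (divr_gt0 M0 (ltr0Sn _ 1)); apply: filterS => n Fn.
  rewrite le_max; have [//|/ltW u1/=] := leP (`|un n|) 1.
  have u0 : 0 < `|un n| by rewrite (lt_le_trans _ u1).
  rewrite ler_pdivlMr ?divr_gt0// -(ler_pM2r u0).
  have qu := powR_ge_sqr u1 (q_ge2 DK).
  have := solution_energy_le (DKn n) (un_sol n).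
  have := opA_strongly_monotone DK 0 (un n); rewrite subr0.
  have := opA_dist_le n (un n) (un n).
  rewrite ler_norml => /andP[+ _].
  have := le_dual_norm (opA D 0) (un n); rewrite ler_norml => /andP[+ _].
  have := le_trans (ler_norm _) (fC n (un n)).
  have cu : cc (Kn n) * `|un n| <= c_tilde * `|un n| by rewrite ler_wpM2r.
  have Mu : cM K * `|un n| ^+ 2 <= cM K * `|un n| `^ cq K.
    by rewrite ler_wpM2l// ltW.
  have Fu : F n * (`|un n| + delta_tilde) * `|un n| <=
            cM K / 2 * (`|un n| + delta_tilde) * `|un n|.
    by rewrite ler_wpM2r// ler_wpM2r// addr_ge0.
  move: Mu Fu; rewrite /E expr2 !(mulrDl, mulrDr); lra.
by exists B => //; exact: le_trans (normr_ge0 _) (uB 0%N).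
Qed.

Lemma multipliers_bounded (c_tilde alpha0 B : R) :
  (forall n, cc (Kn n) <= c_tilde) -> 0 < alpha0 ->
  (forall n, alpha0 <= calpha (Kn n)) -> (forall n, `|un n| <= B) ->
  exists C, forall n, `|lambdan n| <= C.
Proof.
move=> c_le alpha0_gt0 alpha_ge uB; have [C C0 fC] := rhs_bounded.
have B0 := le_trans (normr_ge0 _) (uB 0%N).
have d0 := le_trans (delta_ge0 0%N) (delta_le 0%N).
pose S := [set v : X | `|v| <= B].
have S0 : S 0 by rewrite /S/= normr0.
have [||L L0 AL] := @A_loc_lipschitz _ _ _ _ _ _ DK S; first by exists 0.
  by exists B; split=> [|x Bx y /= yB]; rewrite ?num_real// (le_trans yB)// ltW.
(* The summands bound, in order, the right-hand side, [An - A] at [un n] (when [F n <= 1]), [A] at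
   [un n] by its Lipschitz constant on the ball [S], and [Jn]. *)
apply: (@near_bounded _ _
  ((C + ((B + delta_tilde) + (L * B + `|opA D 0|)) + c_tilde) / alpha0)).
have := F_eventually_le ltr01; apply: filterS => n Fn.
rewrite ler_pdivlMr// mulrC.
apply: (@le_trans _ _ (calpha (Kn n) * `|lambdan n|)); first by rewrite ler_wpM2r.
have fC' w : rhsf (Dn n) (pi w) <= C * `|w| := le_trans (ler_norm _) (fC n w).
rewrite (le_trans (solution_multiplier_le (DKn n) (un_sol n) C0 fC'))//.
rewrite lerD// lerD2l -[opA (Dn n) _](subrK (opA D (un n))).
rewrite (le_trans (ler_normD _ _))// lerD//.
  rewrite (le_trans (opA_dist _ _))// -[leRHS]mul1r; apply: ler_pM => //.
    by rewrite addr_ge0.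
  by rewrite lerD.
rewrite -[opA D (un n)](subrK (opA D 0)) (le_trans (ler_normD _ _))// lerD2r.
rewrite (le_trans (AL _ _ (uB n) S0))// subr0 ler_wpM2l// ltW//.
Qed.

(** * Weak limits of subsequences of solutions *)

Section WeakLimit.
Context (hyp_b : forall (w : nat -> X) (w0 : X), weak_cvg w w0 -> forall v : X,
  (limn_esup (fun n => (funJ (Dn n) (w n) (v - w n)
                        - funJ D (w n) (v - w n))%:E) <= 0)%E).
Context (hyp_f : forall (z : nat -> X) (z0 : X) (mu : nat -> Y) (mu0 : Y),
  weak_cvg z z0 -> weak_cvg mu mu0 -> forall w : X,
  (limn_esup (fun n => (formb (Dn n) (w - z n) (mu n))%:E)
     <= (formb D (w - z0) mu0)%:E)%E).
Context (hyp_h : mosco_cvg (fun n => setLambda (Dn n)) (setLambda D)).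
Context (k : nat -> nat) (k_incr : increasing_seq k).
Context (u : X) (lambda : Y).
Context (un_u : weak_cvg (un \o k) u).
Context (lambdan_lambda : weak_cvg (lambdan \o k) lambda).
Context (B : R) (un_le : forall n, `|un n| <= B).

Let zu := subseq_ext k u un.
Let zl := subseq_ext k lambda lambdan.

Lemma ext_un_weak_cvg : weak_cvg zu u.
Proof. exact: (@cvg_subseq_ext (weak X)). Qed.

Lemma ext_lambdan_weak_cvg : weak_cvg zl lambda.
Proof. exact: (@cvg_subseq_ext (weak Y)). Qed.

(** [A] is still evaluated at [un (k j)], since continuity of [A] cannot be used before strong
    convergence is known. Five errors of size [e / 5] arise: two from [J] and one each from [b], [f]
    and [A]. *)
Lemma weak_limit_near (v : X) (e : R) : 0 < e ->
  \forall j \near \oo, rhsf D (pi (v - u)) <=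
    opA D (un (k j)) (v - un (k j)) + formb D (v - u) lambda
    + funJ D u (v - u) + e.
Proof.
move=> e0; have e5 : 0 < e / 5 by rewrite divr_gt0.
have kk := cvg_increasing_seq k_incr.
have vu : weak_cvg (fun j => v - un (k j)) (v - u).
  apply/weak_cvgP => f; under eq_fun do rewrite linearB/=.
  by rewrite linearB; apply: cvgB; [exact: cvg_cst|exact: (weak_cvgP _ _).1].
have J1 := kk _ (limn_esup_near (hyp_b ext_un_weak_cvg v) e5).
have J2 := limn_esup_near (J_weak_limsup DK un_u vu) e5.
have b1 := kk _
  (limn_esup_near (hyp_f ext_un_weak_cvg ext_lambdan_weak_cvg v) e5).
(* The functionals converge only weakly; complete continuity of [pi] makes their arguments converge
   strongly, so the pairing passes to the limit. *)
have fpi :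
    rhsf (Dn (k j)) (pi (v - un (k j))) @[j --> \oo] --> rhsf D (pi (v - u)).
  apply: cvg_pairing; last exact: pi_completely_continuous vu.
  by move=> z; exact: cvg_comp kk (weak_cvg_eval f_cvg (v := z)).
have /cvgrPdist_lt/(_ _ e5) fpi_near := fpi.
have d0 := le_trans (delta_ge0 0%N) (delta_le 0%N).
have B0 := le_trans (normr_ge0 _) (un_le 0%N).
pose C := (B + delta_tilde) * (`|v| + B) + 1.
have C0 : 0 < C by rewrite ltr_wpDl// mulr_ge0// addr_ge0.
have A1 := kk _ (F_eventually_le (divr_gt0 e5 C0)).
near=> j.
have [_ /(_ v) eq _] := un_sol (k j).
have : `|rhsf D (pi (v - u)) - rhsf (Dn (k j)) (pi (v - un (k j)))| < e / 5.
  by near: j.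
rewrite ltr_norml => /andP[_].
have : funJ (Dn (k j)) (zu (k j)) (v - zu (k j))
         - funJ D (zu (k j)) (v - zu (k j)) < 0 + e / 5 by near: j.
have : formb (Dn (k j)) (v - zu (k j)) (zl (k j))
         < formb D (v - u) lambda + e / 5.
  by near: j.
have : funJ D (un (k j)) (v - un (k j)) < funJ D u (v - u) + e / 5 by near: j.
rewrite /zu /zl !subseq_extE.
have Fe : F (k j) <= e / 5 / C by near: j.
have := opA_dist_le (k j) (un (k j)) (v - un (k j)).
rewrite ler_norml => /andP[_].
have Fu : F (k j) * (`|un (k j)| + delta_tilde) * `|v - un (k j)| <= e / 5.
  apply: (@le_trans _ _ (e / 5 / C * C)); last by rewrite divfK// gt_eqF.
  rewrite -mulrA; apply: ler_pM => //.
    by rewrite mulr_ge0// addr_ge0.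
  rewrite (le_trans _ (ler_wpDr _ (lexx _)))//; apply: ler_pM => //.
  - by rewrite addr_ge0.
  - by rewrite lerD2r.
  - by rewrite (le_trans (ler_normB _ _))// lerD2l.
lra.
Unshelve. all: by end_near. Qed.

(* Testing with v = u makes the monotone part small, which upgrades weak to
   strong convergence. *)
Lemma weak_limit_strong_cvg : un \o k @ \oo --> u.
Proof.
have M0 := M_gt0 DK; have q0 : 0 < cq K by rewrite (lt_le_trans _ (q_ge2 DK)).
apply/cvgrPdist_lt => e e0.
(* The tested inequality and the weak convergence under [opA D u] each cost [d], whereas a distance
   of at least [e] would force [4 * d < 2 * d]. *)
pose d := cM K * e `^ cq K / 4.
have d0 : 0 < d by rewrite divr_gt0// mulr_gt0// powR_gt0.
have /weak_cvgP/(_ (opA D u))/cvgrPdist_lt/(_ _ d0) := un_u.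
apply: filterS2 (weak_limit_near u d0) => j.
rewrite subrr linear0 linear0 (formb0l DK) (funJ0 DK) !addr0 /=.
have := opA_strongly_monotone DK u (un (k j)).
rewrite -(opprB u) !linearN/= ltr_norml normrN linearB/= => mono A1 /andP[_ A2].
rewrite ltNge; apply/negP => ed.
have : cM K * e `^ cq K <= cM K * `|u - un (k j)| `^ cq K.
  by rewrite ler_pM2l// ge0_ler_powR ?nnegrE// ltW.
by move: mono A1 A2 d0; rewrite !linearB/= /d; lra.
Qed.

Lemma weak_limit_solution : mixed_solution pi D u lambda.
Proof.
split.
- apply: (hyp_h.2 _ _ _ k_incr _ lambdan_lambda) => j.
  by have [] := un_sol (k j).
- move=> v; apply/ler_addgt0Pr => e e0.
  have e2 : 0 < e / 2 by rewrite divr_gt0.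
  have uv : v - un (k j) @[j --> \oo] --> v - u.
    by apply: cvgB; [exact: cvg_cst|exact: weak_limit_strong_cvg].
  have Au : opA D (un (k j)) @[j --> \oo] --> opA D u.
    by apply: cvg_comp weak_limit_strong_cvg _; exact: A_continuous DK u.
  have /cvgrPdist_lt/(_ _ e2) := cvg_pairing (cvg_dual_eval Au) uv.
  move=> /(filterI (weak_limit_near v e2))/filter_ex[j []].
  by rewrite ltr_norml => h /andP[h1 _]; lra.
(* A Mosco recovery sequence [m] of [mu] is admissible in the perturbed problems; [hyp_f] with
   [w = 0] then bounds [- b u (mu - lambda)] from below by the perturbed terms, which are
   nonnegative. *)
- move=> mu /(hyp_h.1)[m mL mmu].
  have mzl : weak_cvg (fun n => m n - zl n) (mu - lambda).
    apply/weak_cvgP => f; under eq_fun do rewrite linearB/=.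
    rewrite linearB; apply: cvgB.
      by apply: cvg_comp mmu _; exact: pairing_continuous.
    exact: (weak_cvgP _ _).1 ext_lambdan_weak_cvg f.
  apply/ler_addgt0Pr => e e0; rewrite add0r.
  have : \forall j \near \oo, formb (Dn (k j)) (0 - zu (k j)) (m (k j) - zl (k j))
      < formb D (0 - u) (mu - lambda) + e.
    exact: cvg_increasing_seq k_incr _
      (limn_esup_near (hyp_f ext_un_weak_cvg mzl 0) e0).
  move=> /filter_ex[j]; rewrite /zu /zl !subseq_extE !sub0r.
  rewrite (formbNl DK) (formbNl (DKn _)).
  by have [_ _ /(_ _ (mL (k j)))] := un_sol (k j); lra.
Qed.

End WeakLimit.

End Stability.

Theorem theorem4 (R : realType) (X Y Z : completeNormedModType R)
    (X_refl : reflexive_space X) (Y_refl : reflexive_space Y)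
    (Z_refl : reflexive_space Z)
    (pi : {linear X -> Z}) (pi_continuous : continuous pi)
    (pi_completely_continuous : forall (v : nat -> X) (v0 : X),
      weak_cvg v v0 -> pi (v n) @[n --> \oo] --> pi v0)
    (D : mixed_data X Y Z) (K : constants X) (DK : admissible D K)
    (Dn : nat -> mixed_data X Y Z) (Kn : nat -> constants X)
    (DKn : forall n, admissible (Dn n) (Kn n))
    (u : X) (lambda : Y) (u_sol : mixed_solution pi D u lambda)
    (un : nat -> X) (lambdan : nat -> Y)
    (un_sol : forall n, mixed_solution pi (Dn n) (un n) (lambdan n))
    (hyp_a : exists (F delta : nat -> R) (delta_tilde : R),
      [/\ forall n, 0 <= F n,
          forall n, 0 <= delta n,
          forall n (v : X),
            `|opA (Dn n) v - opA D v| <= F n * (`|v| + delta n),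
          F @ \oo --> (0 : R)
        & forall n, delta n <= delta_tilde])
    (hyp_b_lsc : forall w : X,
      lower_semicontinuous (fun v : weak X => (funJ D w v)%:E))
    (hyp_b : forall (w : nat -> X) (w0 : X), weak_cvg w w0 ->
      (limn_esup (fun n => (funJ D w0 (w n - w0)
                            - funJ (Dn n) w0 (w n - w0))%:E) <= 0)%E /\
      (forall v : X,
        (limn_esup (fun n => (funJ (Dn n) (w n) (v - w n)
                              - funJ D (w n) (v - w n))%:E) <= 0)%E))
    (hyp_c : exists2 M0 : R, 0 < M0 & forall n, M0 <= cM (Kn n) - cm (Kn n))
    (hyp_d : exists2 q_tilde : R, 0 < q_tilde & forall n, q_tilde <= cq (Kn n))
    (hyp_e : exists c_tilde : R, forall n, cc (Kn n) <= c_tilde)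
    (hyp_f : forall (z : nat -> X) (z0 : X) (mu : nat -> Y) (mu0 : Y),
      weak_cvg z z0 -> weak_cvg mu mu0 -> forall w : X,
      (limn_esup (fun n => (formb (Dn n) (w - z n) (mu n))%:E)
         <= (formb D (w - z0) mu0)%:E)%E)
    (hyp_g : exists2 alpha0 : R, 0 < alpha0 &
      forall n, alpha0 <= calpha (Kn n))
    (hyp_h : mosco_cvg (fun n => setLambda (Dn n)) (setLambda D))
    (hyp_i : weak_cvg (fun n => rhsf (Dn n)) (rhsf D)) :
  un @ \oo --> u /\ weak_cvg lambdan lambda.
Proof.
have [F [delta [delta_tilde [F_ge0 delta_ge0 opA_dist F_cvg0 delta_le]]]]
  := hyp_a.
have [c_tilde c_le] := hyp_e; have [alpha0 alpha0_gt0 alpha_ge] := hyp_g.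
have [B B0 uB] := solutions_bounded pi_continuous DK DKn un_sol F_ge0 delta_ge0
  opA_dist F_cvg0 delta_le hyp_i c_le.
have [C lC] := multipliers_bounded pi_continuous DK DKn un_sol F_ge0 delta_ge0
  opA_dist F_cvg0 delta_le hyp_i c_le alpha0_gt0 alpha_ge uB.
have sub k : increasing_seq k -> exists j, [/\ increasing_seq j,
    un \o k \o j @ \oo --> u & weak_cvg (lambdan \o k \o j) lambda].
  move=> ki.
  have [i [u' [ii uu']]] := weak_seq_compact X_refl (fun n => uB (k n)).
  have [j [l' [ji ll']]] := weak_seq_compact Y_refl (fun n => lC (k (i n))).
  have kij := increasing_seq_comp ki (increasing_seq_comp ii ji).
  have u'_cvg : weak_cvg (un \o (k \o (i \o j))) u'.
    exact: cvg_comp (cvg_increasing_seq ji) uu'.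
  have hyp_b2 w w0 (ww : weak_cvg w w0) := (hyp_b w w0 ww).2.
  have sol := weak_limit_solution pi_completely_continuous DK DKn un_sol F_ge0
    delta_ge0 opA_dist F_cvg0 delta_le hyp_i hyp_b2 hyp_f hyp_h kij u'_cvg ll' uB.
  have scvg := weak_limit_strong_cvg pi_completely_continuous DK un_sol F_ge0
    delta_ge0 opA_dist F_cvg0 delta_le hyp_i hyp_b2 hyp_f kij u'_cvg ll' uB.
  have [uE lE] := mixed_solution_unique DK u_sol sol.
  by exists (i \o j); split; rewrite ?uE ?lE//; exact: increasing_seq_comp.
split.
  by apply: cvg_subseq => k /sub[j [ji uj _]]; exists j.
(* The subsequence principle is applied to the real sequence [f (lambdan n)] for each functional
   [f]. *)
apply/weak_cvgP => f; apply: cvg_subseq => k /sub[j [ji _ lj]]; exists j => //.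
exact: (weak_cvgP _ _).1 lj f.
Qed.
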